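(* Let $A,B\in M_{p\times p}(\mathbb{R})$ with $B\neq 0$, and for $t,\tau\in\mathbb{R}$ set $$Z(t,\tau)=e^{A(t-\tau)}+\int_\tau^t e^{A(t-s)}B\,ds.$$ Assume that $Z(t,\tau)$ is invertible for all $t,\tau\in[n,n+1]$ and all $n\in\mathbb{Z}$. Let $f\in\mathbb{Z}AA(\mathbb{R};\mathbb{C}^p)$ and let $x:\mathbb{R}\to\mathbb{C}^p$ be a bounded solution on $\mathbb{R}$ of $$x'(t)=Ax(t)+Bx([t])+f(t).$$ Then $x$ is almost automorphic if and only if the sequence $(x(n))_{n\in\mathbb{Z}}$ is discrete almost automorphic.
   Context: $[\cdot]$ denotes the greatest integer function. $BPC(\mathbb{R};\mathbb{C}^p)$ is the space of bounded functions $\mathbb{R}\to\mathbb{C}^p$ that are continuous on $\mathbb{R}\setminus\mathbb{Z}$ and have finite lateral limits at each integer. A function $f\in BPC(\mathbb{R};\mathbb{C}^p)$ is $\mathbb{Z}$-almost automorphic, written $f\in\mathbb{Z}AA(\mathbb{R};\mathbb{C}^p)$, if for any sequence of integers $\{s_n'\}_{n\in\mathbb{N}}$ there exist a subsequence $\{s_n\}_{n\in\mathbb{N}}$ of $\{s_n'\}$ and a function $\tilde f$ such that, pointwise, $\lim_{n\to\infty}f(t+s_n)=\tilde f(t)$ and $\lim_{n\to\infty}\tilde f(t-s_n)=f(t)$ for every $t\in\mathbb{R}$. A bounded continuous function $f:\mathbb{R}\to\mathbb{C}^p$ is almost automorphic if for any sequence of real numbers $\{s_n'\}$ there exist a subsequence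 $\{s_n\}$ and a function $\tilde f$ such that the same two pointwise limits hold for every $t\in\mathbb{R}$. A function $u:\mathbb{Z}\to\mathbb{C}^p$ is discrete almost automorphic if for any sequence of integers $\{s_n'\}$ there exist a subsequence $\{s_n\}$ and $\tilde u:\mathbb{Z}\to\mathbb{C}^p$ with $\lim_{n\to\infty}u(k+s_n)=\tilde u(k)$ and $\lim_{n\to\infty}\tilde u(k-s_n)=u(k)$ for every $k\in\mathbb{Z}$. A function $x$ is a solution on $\mathbb{R}$ of the equation if (i) $x$ is continuous on $\mathbb{R}$; (ii) $x$ is differentiable on $\mathbb{R}$ except possibly at the points $n\in\mathbb{Z}$, where there should be a lateral derivative; (iii) $x$ satisfies the equation on each open interval $]n,n+1[$, $n\in\mathbb{Z}$, and the equation is also satisfied by the right-hand derivative of $x$ at each $n\in\mathbb{Z}$. *)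

(* Defs.v *)
From mathcomp Require Import all_boot all_order all_algebra.
From mathcomp Require Import complex.
From mathcomp Require Import all_classical all_reals all_analysis.

Set Implicit Arguments.
Unset Strict Implicit.
Unset Printing Implicit Defensive.

Import Order.TTheory GRing.Theory Num.Theory.
Import numFieldNormedType.Exports.

Local Open Scope ring_scope.
Local Open Scope complex_scope.
Local Open Scope classical_set_scope.

(* R[i] packaged as a numFieldType: this is what gives it the topology of the
   modulus. 'cV[Cplx R]_p then carries the sup norm, which induces the usual
   topology and bounded sets of C^p. *)
Definition Cplx (R : realType) : numFieldType := R[i].

Section MatrixDefs.
Context {R : realType} {p : nat}.
Implicit Types (A B : 'M[R]_p) (F : R -> 'M[R]_p) (t tau : R).

Definition expmx A : 'M[R]_p :=
  limn (series (fun k : nat => k`!%:R^-1 *: A ^+ k)).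

(* Entrywise and oriented: a > b is allowed, and then the integral from
   a to b is the opposite of the integral over [b, a]. *)
Definition integral_mx F (a b : R) : 'M[R]_p :=
  \matrix_(i, j)
    (if a <= b then \int[lebesgue_measure]_(s in `[a, b]) F s i j
     else - \int[lebesgue_measure]_(s in `[b, a]) F s i j).

Definition Zmx A B t tau : 'M[R]_p :=
  expmx ((t - tau) *: A)
  + integral_mx (fun s => expmx ((t - s) *: A) *m B) tau t.

End MatrixDefs.

Section Automorphy.
Context {R : realType} {p : nat}.
Implicit Types (f x : R -> 'cV[Cplx R]_p) (u : int -> 'cV[Cplx R]_p).

(* The values at the integers are not related to the lateral limits. *)
Definition BPC f : Prop :=
  [/\ bounded_fun f,
      forall t, t \isn't a Num.int -> {for t, continuous f} &
      forall n : int, cvg (f @ n%:~R^'-) /\ cvg (f @ n%:~R^'+)].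

Definition Z_almost_automorphic f : Prop :=
  BPC f /\
  forall s : nat -> int, exists phi : nat -> nat, increasing_seq phi /\
    exists g : R -> 'cV[Cplx R]_p, forall t,
      f (t + (s (phi n))%:~R) @[n --> \oo] --> g t /\
      g (t - (s (phi n))%:~R) @[n --> \oo] --> f t.

Definition almost_automorphic x : Prop :=
  [/\ bounded_fun x, continuous x &
      forall s : nat -> R, exists phi : nat -> nat, increasing_seq phi /\
        exists g : R -> 'cV[Cplx R]_p, forall t,
          x (t + s (phi n)) @[n --> \oo] --> g t /\
          g (t - s (phi n)) @[n --> \oo] --> x t].

Definition discrete_almost_automorphic u : Prop :=
  forall s : nat -> int, exists phi : nat -> nat, increasing_seq phi /\
    exists v : int -> 'cV[Cplx R]_p, forall k,
      u (k + s (phi n)) @[n --> \oo] --> v k /\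
      v (k - s (phi n)) @[n --> \oo] --> u k.

End Automorphy.

Section Solutions.
Context {R : realType} {p : nat}.
Implicit Types (A B : 'M[R]_p) (f x : R -> 'cV[Cplx R]_p) (t : R)
  (d : 'cV[Cplx R]_p).

(* The library's derivatives need domain and codomain over the same scalars;
   here the variable is real and 'cV[Cplx R]_p is a Cplx R-module. *)
Definition diff_quot x t (h : R) : 'cV[Cplx R]_p :=
  h^-1%:C *: (x (t + h) - x t).

Definition has_deriv x t d : Prop := diff_quot x t h @[h --> 0^'] --> d.
Definition has_right_deriv x t d : Prop := diff_quot x t h @[h --> 0^'+] --> d.
Definition has_left_deriv x t d : Prop := diff_quot x t h @[h --> 0^'-] --> d.

Definition depca_rhs A B f x t : 'cV[Cplx R]_p :=
  map_mx (real_complex R) A *m x t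
  + map_mx (real_complex R) B *m x (Num.floor t)%:~R
  + f t.

Definition is_solution A B f x : Prop :=
  [/\ continuous x,
      (forall t, t \isn't a Num.int -> exists d, has_deriv x t d),
      (forall n : int, exists d,
         has_left_deriv x n%:~R d \/ has_right_deriv x n%:~R d),
      (forall (n : int) t, n%:~R < t < (n + 1)%:~R ->
         has_deriv x t (depca_rhs A B f x t)) &
      (forall n : int, has_right_deriv x n%:~R (depca_rhs A B f x n%:~R))].

End Solutions.

(* Main.v *)
Require Import Defs.
From mathcomp Require Import all_boot all_order all_algebra.
From mathcomp Require Import complex.
From mathcomp Require Import all_classical all_reals all_analysis.
From mathcomp Require Import measurable_realfun.
From mathcomp Require Import ring lra.
Import Order.TTheory GRing.Theory Num.Theory.
Import numFieldNormedType.Exports.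
Local Open Scope ring_scope.
Local Open Scope complex_scope.
Local Open Scope classical_set_scope.

(** The forward implication is a restriction: sequences of integers are
    sequences of reals.

    For the converse, write a real sequence [s] as [N + r] with [N] integer and
    [0 <= r < 1]. Along a subsequence [r] converges, the translates [f (t + N)]
    converge pointwise to some [ft], and [x (k + N)] converges to some [v k] for
    every integer [k], each limit being reversible. The point is that then
    [x (t + N)] converges for every real [t], to a function [y] with
    [y (t - N)] converging back to [x t] ([integer_translates_cvg]).

    Since [A] and [B] are real, the real and imaginary parts of [x] solve the
    same real system, and on a cell [[k, k + 1]] the fundamental theorem of
    calculus turns it into an integral equation whose delayed term is the
    constant [B * x k] ([solution_mild]). The limit [ft] need not be continuous
    inside the cells, so it is the integral form that survives the passage to the
    limit, by dominated convergence ([mild_lim]). By Gronwall's inequality two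
    solutions of the integral equation on a cell differ by at most a constant
    times the difference of their values at [k] plus the L1 distance of their
    forcing terms ([mild_stability]). Hence the sequence [x (t + N)] is Cauchy
    ([mild_cauchy]), its limit [y] solves the equation forced by [ft], and
    [y (t - N)], which is forced by [ft (t - N)] and starts from [v (k - N)],
    converges to [x] ([mild_cvg]).

    Finally solutions bounded by a common constant are uniformly Lipschitz
    ([mild_lipschitz]), so replacing [r] by its limit changes nothing in the
    limit, and [t |-> y (t + lim r)] is the function required for [s]. *)

(** * Bounded measurable functions on segments *)

Section BoundedMeasurable.
Context {R : realType}.
Implicit Types (F G : R -> R) (a b t : R).
Notation mu := (@lebesgue_measure R).

(** Stable under the operations that build the right-hand side of the equation,
    and integrable over every segment: all integrability conditions below reduce
    to it. *)
Definition bmeas F : Prop :=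
  measurable_fun setT F /\ exists M, forall t, `|F t| <= M.

Lemma bmeas_cst c : bmeas (fun=> c).
Proof. by split=> //; exists `|c|. Qed.

Lemma bmeasD F G : bmeas F -> bmeas G -> bmeas (fun t => F t + G t).
Proof.
move=> [mF [M FM]] [mG [N GN]]; split; first exact: measurable_funD.
by exists (M + N) => t; rewrite (le_trans (ler_normD _ _))// lerD.
Qed.

Lemma bmeasZ c F : bmeas F -> bmeas (fun t => c * F t).
Proof.
move=> [mF [M FM]]; split; first exact: measurable_funM.
by exists (`|c| * M) => t; rewrite normrM ler_wpM2l.
Qed.

Lemma bmeasB F G : bmeas F -> bmeas G -> bmeas (fun t => F t - G t).
Proof.
move=> mF /(bmeasZ (-1)) mG.
by under eq_fun do rewrite -mulN1r; exact: bmeasD.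
Qed.

Lemma bmeas_norm F : bmeas F -> bmeas (fun t => `|F t|).
Proof.
move=> [mF [M FM]]; split; first exact: measurableT_comp.
by exists M => t; rewrite normr_id.
Qed.

Lemma bmeas_sum I (s : seq I) (F : I -> R -> R) :
  (forall i, bmeas (F i)) -> bmeas (fun t => \sum_(i <- s) F i t).
Proof.
move=> bF; elim: s => [|i s IHs].
  by under eq_fun do rewrite big_nil; exact: bmeas_cst.
by under eq_fun do rewrite big_cons; exact: bmeasD.
Qed.

Lemma bmeas_integrable F a b : bmeas F ->
  mu.-integrable `[a, b] (EFin \o F).
Proof.
move=> [mF [M FM]]; apply: measurable_bounded_integrable => //.
- rewrite /= lebesgue_measure_itv/=; case: ifPn => _; last exact: ltry.
  by rewrite -EFinB ltry.
- exact: measurable_funTS.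
- exists M; split; first exact: num_real.
  by move=> c Mc t _ /=; exact: le_trans (FM t) (ltW Mc).
Qed.

Lemma Rintegral_cst_itv c a b : a <= b ->
  \int[mu]_(s in `[a, b]) c = c * (b - a).
Proof.
move=> ab; rewrite Rintegral_cst//= lebesgue_measure_itv/=.
case: ifPn => [_ //|]; rewrite lte_fin -leNgt => ba.
have -> : b = a by apply/eqP; rewrite eq_le ba ab.
by rewrite subrr.
Qed.

Lemma bmeas_le_Rintegral F G a b : bmeas F -> bmeas G ->
  (forall t, a <= t <= b -> F t <= G t) ->
  \int[mu]_(s in `[a, b]) F s <= \int[mu]_(s in `[a, b]) G s.
Proof.
move=> bF bG FG; by apply: le_Rintegral => //; exact: bmeas_integrable.
Qed.

Lemma bmeas_Rintegral_sub F a b c : bmeas F -> a <= b -> b <= c ->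
  (forall t, 0 <= F t) ->
  \int[mu]_(s in `[a, b]) F s <= \int[mu]_(s in `[a, c]) F s.
Proof.
move=> bF ab bc F0; rewrite -subr_ge0 Rintegral_itvB ?bnd_simp//.
  by apply: Rintegral_ge0 => t _; exact: F0.
exact: bmeas_integrable.
Qed.

Lemma bmeas_dist_Rintegral F M a b c : bmeas F -> a <= b -> b <= c ->
  (forall t, `|F t| <= M) ->
  `|\int[mu]_(s in `[a, c]) F s - \int[mu]_(s in `[a, b]) F s| <= M * (c - b).
Proof.
move=> bF ab bc FM; rewrite Rintegral_itvB ?bnd_simp//; last exact: bmeas_integrable.
rewrite Rintegral_itv_obnd_cbnd; last first.
  apply: (integrableS _ _ _ (bmeas_integrable F b c bF)) => //.
  by apply: subset_itv; rewrite bnd_simp.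
rewrite (le_trans (le_normr_Rintegral _ _))//=; first exact: bmeas_integrable.
rewrite -Rintegral_cst_itv//; apply: bmeas_le_Rintegral => //.
  exact: bmeas_norm.
exact: bmeas_cst.
Qed.

Lemma cvg_sum {T I : Type} (F : set_system T) {FF : Filter F} (s : seq I)
    (f : I -> T -> R) (l : I -> R) :
  (forall i, f i t @[t --> F] --> l i) ->
  \sum_(i <- s) f i t @[t --> F] --> \sum_(i <- s) l i.
Proof. by move=> fl; apply: cvg_big => // *; exact: add_continuous. Qed.

Lemma cvgn_norm_le (u : nat -> R) (l M : R) : (forall n, `|u n| <= M) ->
  u n @[n --> \oo] --> l -> `|l| <= M.
Proof.
move=> uM ul; rewrite -(cvg_lim _ (cvg_norm ul))//.
apply: limr_le; first by apply/cvg_ex; eexists; exact: cvg_norm ul.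
exact: nearW.
Qed.

(** Dominated convergence with a constant as dominating function. The measurability
    of [F] comes from that of the sequence. *)
Lemma bounded_convergence (F_ : nat -> R -> R) F M a b :
  (forall n, measurable_fun setT (F_ n)) -> (forall n t, `|F_ n t| <= M) ->
  (forall t, F_ n t @[n --> \oo] --> F t) ->
  \int[mu]_(s in `[a, b]) `|F_ n s - F s| @[n --> \oo] --> (0 : R).
Proof.
move=> mF FM FF.
have mF' : measurable_fun setT F by apply: measurable_fun_cvg mF _ => t _; exact: FF.
have FM' t : `|F t| <= M.
  exact: cvgn_norm_le (FF t).
have bF : bmeas F by split=> //; exists M.
have bFn n : bmeas (F_ n) by split=> //; exists M.
have mfn n : measurable_fun `[a, b] (EFin \o F_ n).
  by apply/measurable_EFinP; exact: measurable_funTS.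
have mf : measurable_fun `[a, b] (EFin \o F).
  by apply/measurable_EFinP; exact: measurable_funTS.
have [] := @dominated_convergence _ _ _ mu `[a, b]%classic _
  (fun n => EFin \o F_ n) (EFin \o F) (fun=> M%:E) mfn mf.
- exact: measurable_itv.
- by apply: aeW => t _; apply/fine_cvgP; split; [exact: nearW|exact: FF].
- exact: (bmeas_integrable _ a b (bmeas_cst M)).
- by apply: aeW => t n _; rewrite lee_fin.
move=> _ + _ => /fine_cvgP[_]; apply: cvg_trans; apply: near_eq_cvg.
exact: nearW.
Qed.

Lemma bounded_convergence_Rintegral (F_ : nat -> R -> R) F M a b :
  (forall n, measurable_fun setT (F_ n)) -> (forall n t, `|F_ n t| <= M) ->
  (forall t, F_ n t @[n --> \oo] --> F t) ->
  \int[mu]_(s in `[a, b]) F_ n s @[n --> \oo] --> \int[mu]_(s in `[a, b]) F s.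
Proof.
move=> mF FM FF; have bFn n : bmeas (F_ n) by split=> //; exists M.
have bF : bmeas F.
  split; first by apply: measurable_fun_cvg mF _ => t _; exact: FF.
  by exists M => t; exact: cvgn_norm_le (FF t).
apply/subr_cvg0/norm_cvg0P.
apply: (squeeze_cvgr (f := fun=> 0)
  (h := fun n => \int[mu]_(s in `[a, b]) `|F_ n s - F s|)).
- apply: nearW => n; rewrite normr_ge0/= -RintegralB//; [|exact: bmeas_integrable..].
  apply: le_normr_Rintegral => //.
  by apply: bmeas_integrable; exact: bmeasB.
- exact: cvg_cst.
- exact: bounded_convergence FF.
Qed.

Lemma cvgn_dist_le (u q : nat -> R) :
  (forall n m, `|u n - u m| <= q n + q m) -> q @ \oo --> (0 : R) -> cvgn u.
Proof.
move=> uq q0; apply/cauchy_cvgP/cauchy_ballP => eps eps0; near_simpl.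
have half : \forall n \near \oo, q n < eps / 2.
  by apply: (cvgr_lt _ q0); rewrite divr_gt0.
near=> n m => /=; rewrite /ball/= (le_lt_trans (uq _ _))// [eps]splitr ltrD//.
  by near: n; exact: half.
by near: m; exact: half.
Unshelve. all: end_near. Qed.

End BoundedMeasurable.

(** * Gronwall's inequality *)

Section Gronwall.
Context {R : realType}.
Implicit Types (a b c t : R).
Notation mu := (@lebesgue_measure R).

Lemma is_derive_expR_affine a c (s : R) :
  is_derive s 1 (fun u : R => expR (c * (u - a))) (c * expR (c * (s - a))).
Proof.
have -> : (fun u => expR (c * (u - a))) = expR \o (fun u => c * (u - a)) by [].
have daff : is_derive s 1 (fun u : R => c * (u - a)) c.
  have -> : (fun u : R => c * (u - a)) = c *: (id - cst a).
    by apply/funext => u.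
  by apply: is_derive_eq; rewrite subr0 [LHS]mulr1.
rewrite mulrC.
exact: (@is_derive1_comp _ expR (fun u : R => c * (u - a)) s _ _
  (is_derive_expR _) daff).
Qed.

Lemma continuous_expR_affine a c : continuous (fun u : R => expR (c * (u - a))).
Proof.
move=> s; apply: differentiable_continuous; apply/derivable1_diffP.
by have [] := is_derive_expR_affine a c s.
Qed.

Lemma integrable_expR_affine a b c :
  mu.-integrable `[a, b] (EFin \o (fun u : R => expR (c * (u - a)))).
Proof.
apply: continuous_compact_integrable; first exact: segment_compact.
exact/continuous_subspaceT/continuous_expR_affine.
Qed.

Lemma Rintegral_expR_affine_le a t c : 0 < c -> a <= t ->
  \int[mu]_(s in `[a, t]) expR (c * (s - a)) <= expR (c * (t - a)) / c.
Proof.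
move=> c0; rewrite le_eqVlt => /predU1P[<-|at_].
  by rewrite set_itv1 Rintegral_set1 divr_ge0 ?expR_ge0// ltW.
pose P (s : R) : R := c^-1 * expR (c * (s - a)).
have dP (s : R) : is_derive s 1 P (expR (c * (s - a))).
  have -> : P = c^-1 *: (fun s : R => expR (c * (s - a))) by apply/funext.
  have := is_deriveZ c^-1 (is_derive_expR_affine a c s).
  by rewrite [X in is_derive _ _ _ X]mulrA mulVf ?gt_eqF// mul1r.
have cP : continuous P.
  move=> s; apply: differentiable_continuous; apply/derivable1_diffP.
  by have [] := dP s.
rewrite /Rintegral (@continuous_FTC2 _ _ P)//.
- rewrite /= /P subrr mulr0 expR0 mulr1 mulrC lerBlDr lerDl.
  by rewrite invr_ge0 ltW.
- exact/continuous_subspaceT/continuous_expR_affine.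
- split; first by move=> s _; have [] := dP s.
  + exact/cvg_at_right_filter/cP.
  + exact/cvg_at_left_filter/cP.
- by move=> s _; rewrite derive1E; have [_ ->] := dP s.
Qed.

(** Let [S] be the supremum over [[a, b]] of [e t * expR (- c * (t - a))].
    Integrating [e s <= S * expR (c * (s - a))] in the hypothesis gives
    [S <= C + L / c * S], and the rate [c = 2 * L + 1] makes [L / c <= 1 / 2], so
    that the last term can be absorbed. *)
Lemma gronwall (e : R -> R) a b L C : a <= b -> 0 <= L ->
  bmeas e -> (forall t, 0 <= e t) ->
  (forall t, a <= t <= b -> e t <= C + L * \int[mu]_(s in `[a, t]) e s) ->
  forall t, a <= t <= b -> e t <= 2 * C * expR ((2 * L + 1) * (t - a)).
Proof.
move=> ab L0 be e0 eint; set c := 2 * L + 1.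
have c0 : 0 < c by rewrite /c; lra.
have [_ [M eM]] := be.
have C0 : 0 <= C.
  have := eint a; rewrite lexx ab => /(_ isT).
  rewrite set_itv1 Rintegral_set1 mulr0 addr0; exact: le_trans.
pose W := [set e t * expR (- (c * (t - a))) | t in `[a, b]].
have W0 : W !=set0.
  by exists (e a * expR (- (c * (a - a)))), a => //=; rewrite in_itv/= lexx.
have Wub : has_ubound W.
  exists M => _ [t /= + <-]; rewrite in_itv/= => /andP[at_ _].
  rewrite -[M]mulr1 ler_pM ?expR_ge0//; first exact: le_trans (ler_norm _) (eM t).
  by rewrite -expR0 ler_expR oppr_le0 mulr_ge0 ?subr_ge0// ltW.
set S := sup W.
have eS t : a <= t <= b -> e t <= S * expR (c * (t - a)).
  move=> atb; have : e t * expR (- (c * (t - a))) <= S.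
    by apply: ub_le_sup => //; exists t => //=; rewrite in_itv.
  by rewrite expRN ler_pdivrMr ?expR_gt0.
have S0 : 0 <= S.
  have := eS a; rewrite lexx ab subrr mulr0 expR0 mulr1 => /(_ isT).
  exact: le_trans.
have SC : S <= C + S / 2.
  apply: ge_sup => // _ [t /= + <-]; rewrite in_itv/= => atb.
  have /andP[at_ tb] := atb.
  rewrite expRN ler_pdivrMr ?expR_gt0//.
  apply: (le_trans (eint t atb)).
  have intS : \int[mu]_(s in `[a, t]) e s <= S * (expR (c * (t - a)) / c).
    rewrite (le_trans _ (ler_wpM2l S0 (Rintegral_expR_affine_le a t c c0 at_)))//.
    rewrite -RintegralZl//; last exact: integrable_expR_affine.
    apply: le_Rintegral => //; first exact: bmeas_integrable.
      have -> : EFin \o (fun x => S * expR (c * (x - a))) =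
          (fun x => (S%:E * (EFin \o (fun u : R => expR (c * (u - a)))) x)%E) by [].
      by apply: integrableZl => //; exact: integrable_expR_affine.
    move=> s; rewrite /= in_itv/= => /andP[as_ st]; apply: eS.
    by rewrite as_ (le_trans st tb).
  have E1 : 1 <= expR (c * (t - a)).
    by rewrite -expR0 ler_expR mulr_ge0 ?subr_ge0// ltW.
  rewrite mulrDl lerD//; first by rewrite -[leLHS]mulr1 ler_wpM2l.
  rewrite (le_trans (ler_wpM2l L0 intS))//.
  have -> : L * (S * (expR (c * (t - a)) / c)) = S * expR (c * (t - a)) * (L / c) by lra.
  have -> : S / 2 * expR (c * (t - a)) = S * expR (c * (t - a)) * 2^-1 by lra.
  rewrite ler_wpM2l ?mulr_ge0 ?expR_ge0//.
  by rewrite ler_pdivrMr// /c; lra.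
move=> t atb; rewrite (le_trans (eS t atb))// ler_wpM2r ?expR_ge0//; lra.
Qed.

End Gronwall.

(** * The integral equation on unit cells *)

Section MildSolutions.
Context {R : realType} {p : nat}.
Variables (A B : 'M[R]_p).
Implicit Types (C : 'M[R]_p) (phi psi w z : 'I_p -> R -> R) (M t : R) (k : int).
Notation mu := (@lebesgue_measure R).

(** The delayed argument is the cell index [k] and not the integer part of [s]:
    at the right end of the cell [[k, k + 1]] the two differ, and the integral
    equation needs the field of the cell. *)
Definition depca_field phi w k i s : R :=
  \sum_j A i j * w j s + \sum_j B i j * w j k%:~R + phi i s.

(** The bound [M] is part of the notion so that it is common to all members of a
    sequence, as dominated convergence and the Lipschitz estimate require. *)
Definition mild M phi w : Prop :=
  [/\ forall i, measurable_fun setT (w i),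
      forall i, measurable_fun setT (phi i),
      forall i t, `|w i t| <= M,
      forall i t, `|phi i t| <= M &
      forall k i t, k%:~R <= t <= (k + 1)%:~R ->
        w i t = w i k%:~R + \int[mu]_(s in `[k%:~R, t]) depca_field phi w k i s].

Definition mx_l1 (C : 'M[R]_p) : R := \sum_i \sum_j `|C i j|.

Lemma mx_l1_ge0 C : 0 <= mx_l1 C.
Proof. by apply: sumr_ge0 => i _; apply: sumr_ge0. Qed.

Lemma ler_row_mx_l1 C i : \sum_j `|C i j| <= mx_l1 C.
Proof.
rewrite [leRHS](bigD1 i)//= lerDl.
by apply: sumr_ge0 => ? _; apply: sumr_ge0.
Qed.

Lemma ler_coef_mx_l1 C i j : `|C i j| <= mx_l1 C.
Proof.
apply: le_trans (ler_row_mx_l1 C i).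
by rewrite (bigD1 j)//= lerDl; apply: sumr_ge0.
Qed.

Lemma ler_norm_mulmx_l1 C (v : 'I_p -> R) i :
  `|\sum_j C i j * v j| <= mx_l1 C * \sum_j `|v j|.
Proof.
rewrite (le_trans (ler_norm_sum _ _ _))// mulr_sumr ler_sum// => j _.
by rewrite normrM ler_wpM2r// ler_coef_mx_l1.
Qed.

Lemma ler_norm_mulmx_sup C (v : 'I_p -> R) N i : (forall j, `|v j| <= N) ->
  `|\sum_j C i j * v j| <= mx_l1 C * N.
Proof.
move=> vN; have N0 : 0 <= N by apply: le_trans (vN i).
rewrite (le_trans (ler_norm_sum _ _ _))//.
apply: le_trans (ler_wpM2r N0 (ler_row_mx_l1 C i)).
by rewrite mulr_suml ler_sum// => j _; rewrite normrM ler_wpM2l.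
Qed.

Lemma depca_field_bound M phi w k i s : mild M phi w ->
  `|depca_field phi w k i s| <= (mx_l1 A + mx_l1 B + 1) * M.
Proof.
case=> _ _ wM phiM _; rewrite !mulrDl mul1r.
rewrite (le_trans (ler_normD _ _))// lerD//.
by rewrite (le_trans (ler_normD _ _))// lerD// ler_norm_mulmx_sup.
Qed.

Lemma bmeas_depca_field M phi w k i : mild M phi w ->
  bmeas (depca_field phi w k i).
Proof.
case=> mw mphi wM phiM _.
apply: bmeasD; last by split=> //; exists M.
apply: bmeasD; last exact: bmeas_cst.
by apply: bmeas_sum => j; apply: bmeasZ; split=> //; exists M.
Qed.

Lemma mild_sub_bmeas M phi psi w z i : mild M phi w -> mild M psi z ->
  bmeas (fun t => w i t - z i t) /\ bmeas (fun t => phi i t - psi i t).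
Proof.
case=> mw mphi wM phiM _ [mz mpsi zM psiM _].
by split; apply: bmeasB; split=> //; exists M.
Qed.

(** The hypothesis of Gronwall's inequality for the l1 distance of [w] and [z],
    one coordinate at a time. The delayed term and the forcing term are estimated
    over the whole cell, which has length 1, so that only the integral of the
    distance itself still depends on [t]. *)
Lemma mild_stability_coef M phi psi w z k i t :
  mild M phi w -> mild M psi z -> k%:~R <= t <= (k + 1)%:~R ->
  `|w i t - z i t| <=
    `|w i k%:~R - z i k%:~R| + mx_l1 B * (\sum_j `|w j k%:~R - z j k%:~R|)
    + \int[mu]_(s in `[k%:~R, (k + 1)%:~R]) `|phi i s - psi i s|
    + mx_l1 A * \int[mu]_(s in `[k%:~R, t]) (\sum_j `|w j s - z j s|).
Proof.
move=> mw mz ktk; have [kt tk] := andP ktk.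
have [_ _ _ _ /(_ k i t ktk) ->] := mw.
have [_ _ _ _ /(_ k i t ktk) ->] := mz.
have bw := bmeas_depca_field M phi w k i mw.
have bz := bmeas_depca_field M psi z k i mz.
rewrite opprD addrACA (le_trans (ler_normD _ _))// -!addrA lerD2l.
rewrite -RintegralB//; last 2 first; [exact: bmeas_integrable..|].
rewrite (le_trans (le_normr_Rintegral _ _))//=.
  by apply: bmeas_integrable; exact: bmeasB.
have be : bmeas (fun s => \sum_j `|w j s - z j s|).
  apply: bmeas_sum => j; apply: bmeas_norm.
  by have [] := mild_sub_bmeas M phi psi w z j mw mz.
have bd : bmeas (fun s => `|phi i s - psi i s|).
  by apply: bmeas_norm; have [] := mild_sub_bmeas M phi psi w z i mw mz.
set b := mx_l1 B * _.
have b0 : 0 <= b by rewrite mulr_ge0 ?mx_l1_ge0 ?sumr_ge0.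
have bt : \int[mu]_(s in `[k%:~R, t]) b <= b.
  rewrite Rintegral_cst_itv// ler_piMr//.
  by move: tk; rewrite intrD lerBlDr addrC.
have dt : \int[mu]_(s in `[k%:~R, t]) `|phi i s - psi i s| <=
    \int[mu]_(s in `[k%:~R, (k + 1)%:~R]) `|phi i s - psi i s|.
  exact: bmeas_Rintegral_sub.
rewrite (le_trans _ (lerD bt (lerD dt (lexx _))))//.
rewrite -RintegralZl//; last exact: bmeas_integrable.
have bAe := bmeasZ (mx_l1 A) _ be.
have bdAe := bmeasD _ _ bd bAe.
have bbdAe := bmeasD _ _ (bmeas_cst b) bdAe.
rewrite -RintegralD//; last 2 first; [exact: bmeas_integrable..|].
rewrite -RintegralD//; last 2 first.
- exact/bmeas_integrable/bmeas_cst.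
- exact: bmeas_integrable.
apply: bmeas_le_Rintegral => //; first exact/bmeas_norm/bmeasB.
move=> s _; rewrite /depca_field.
have -> : \sum_j A i j * w j s + \sum_j B i j * w j k%:~R + phi i s -
    (\sum_j A i j * z j s + \sum_j B i j * z j k%:~R + psi i s) =
    \sum_j B i j * (w j k%:~R - z j k%:~R) + ((phi i s - psi i s) +
    \sum_j A i j * (w j s - z j s)).
  under [X in _ = X + _]eq_bigr do rewrite mulrBr.
  under [X in _ = _ + (_ + X)]eq_bigr do rewrite mulrBr.
  rewrite !sumrB; ring.
rewrite (le_trans (ler_normD _ _))// lerD//; first exact: ler_norm_mulmx_l1.
by rewrite (le_trans (ler_normD _ _))// lerD// ler_norm_mulmx_l1.
Qed.

(** The data of the initial value problem on the cell [[k, k + 1]]: initial values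
    in l1, forcing terms in L1. *)
Definition stability_gap phi psi w z k : R :=
  \sum_i (`|w i k%:~R - z i k%:~R|
  + \int[mu]_(s in `[k%:~R, (k + 1)%:~R]) `|phi i s - psi i s|).

(** The constant depends only on [A], [B] and [p]; in particular it is the same for
    all cells. *)
Lemma mild_stability : exists2 C : R, 0 <= C &
  forall M phi psi w z k i t, mild M phi w -> mild M psi z ->
  k%:~R <= t <= (k + 1)%:~R ->
  `|w i t - z i t| <= C * stability_gap phi psi w z k.
Proof.
pose a := mx_l1 A; pose b := mx_l1 B.
have a0 : 0 <= a := mx_l1_ge0 A; have b0 : 0 <= b := mx_l1_ge0 B.
pose L := p%:R * a.
have L0 : 0 <= L by rewrite mulr_ge0.
exists (2 * (1 + p%:R * b) * expR (2 * L + 1)).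
  by rewrite !mulr_ge0 ?expR_ge0// addr_ge0// mulr_ge0.
move=> M phi psi w z k i t mw mz ktk.
pose e s := \sum_j `|w j s - z j s|.
have be : bmeas e.
  apply: bmeas_sum => j; apply: bmeas_norm.
  by have [] := mild_sub_bmeas M phi psi w z j mw mz.
have e0 s : 0 <= e s by exact: sumr_ge0.
set gap := stability_gap phi psi w z k.
have ekgap : e k%:~R <= gap.
  by apply: ler_sum => j _; rewrite lerDl Rintegral_ge0.
have gap0 : 0 <= gap := le_trans (e0 _) ekgap.
have kk1 : k%:~R <= (k + 1)%:~R :> R by rewrite ler_int lerDl.
have eint s : k%:~R <= s <= (k + 1)%:~R ->
    e s <= (1 + p%:R * b) * gap + L * \int[mu]_(u in `[k%:~R, s]) e u.
  move=> ksk.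
  apply: (@le_trans _ _ (\sum_(j < p) (`|w j k%:~R - z j k%:~R|
     + \int[mu]_(s in `[k%:~R, (k + 1)%:~R]) `|phi j s - psi j s|
     + (b * gap + a * \int[mu]_(u in `[k%:~R, s]) e u)))).
    apply: ler_sum => j _.
    apply: (le_trans (mild_stability_coef M phi psi w z k j s mw mz ksk)).
    rewrite [leRHS]addrA lerD2r -!addrA lerD2l addrC lerD2l.
    exact: ler_wpM2l.
  rewrite big_split/= sumr_const card_ord -[X in _ + X <= _]mulr_natl mulrDr addrA lerD//.
    by rewrite mulrDl mul1r lerD// mulrA.
  by rewrite /L mulrA.
have [kt tk] := andP ktk.
have le1 : (2 * L + 1) * (t - k%:~R) <= 2 * L + 1.
  rewrite ler_piMr//; first by rewrite addr_ge0// mulr_ge0.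
  by move: tk; rewrite intrD lerBlDl.
have it_le : `|w i t - z i t| <= e t.
  by rewrite /e (bigD1 i)//= lerDl; apply: sumr_ge0.
rewrite (le_trans it_le)// (le_trans (gronwall e _ _ _ _ kk1 L0 be e0 eint t ktk))//.
rewrite mulrA mulrAC ler_wpM2r// ler_wpM2l ?ler_expR//.
by rewrite mulr_ge0// addr_ge0// mulr_ge0.
Qed.

Lemma stability_gap_cvg0 M (phi_ w_ : nat -> 'I_p -> R -> R) phi w k :
  (forall n i, measurable_fun setT (phi_ n i)) ->
  (forall n i t, `|phi_ n i t| <= M) ->
  (forall i t, phi_ n i t @[n --> \oo] --> phi i t) ->
  (forall i, w_ n i k%:~R @[n --> \oo] --> w i k%:~R) ->
  stability_gap (phi_ n) phi (w_ n) w k @[n --> \oo] --> (0 : R).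
Proof.
move=> mphi phiM phicvg wcvg.
have -> : 0 = \sum_(i < p) (0 : R) by rewrite big1.
apply: cvg_sum => i; rewrite -[X in _ --> X]addr0; apply: cvgD.
  apply/norm_cvg0P; rewrite -[X in _ --> X](subrr (w i k%:~R)).
  by apply: cvgB; [exact: wcvg|exact: cvg_cst].
by apply: (@bounded_convergence _ (fun n => phi_ n i) _ M) => // t; exact: phicvg.
Qed.

Lemma mild_cvg M (phi_ w_ : nat -> 'I_p -> R -> R) phi w :
  (forall n, mild M (phi_ n) (w_ n)) -> mild M phi w ->
  (forall i t, phi_ n i t @[n --> \oo] --> phi i t) ->
  (forall k i, w_ n i k%:~R @[n --> \oo] --> w i k%:~R) ->
  forall i t, w_ n i t @[n --> \oo] --> w i t.
Proof.
move=> mw_ mw phicvg wcvg i t.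
have [C C0 stab] := mild_stability.
set k := Num.floor t.
have ktk : k%:~R <= t <= (k + 1)%:~R.
  by rewrite floor_le ltW// floorD1_gt.
apply/subr_cvg0/norm_cvg0P.
apply: (squeeze_cvgr (f := fun=> 0)
    (h := fun n => C * stability_gap (phi_ n) phi (w_ n) w k)).
- by apply: nearW => n; rewrite normr_ge0/=; exact: (stab M).
- exact: cvg_cst.
- rewrite -[X in _ --> X](mulr0 C); apply: cvgMr.
  apply: (@stability_gap_cvg0 M) => [n j|n j s| |]//.
  + by have [] := mw_ n.
  + by have [] := mw_ n.
Qed.

(** No limit function is given in advance: [w_ n] and [w_ m] are compared with
    each other, through a gap that splits into a part depending on [n] and a part
    depending on [m]. *)
Lemma mild_cauchy M (phi_ w_ : nat -> 'I_p -> R -> R) phi :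
  (forall n, mild M (phi_ n) (w_ n)) ->
  (forall i t, phi_ n i t @[n --> \oo] --> phi i t) ->
  (forall k i, cvgn (fun n => w_ n i k%:~R)) ->
  forall i t, cvgn (fun n => w_ n i t).
Proof.
move=> mw_ phicvg wcvg i t.
have [C C0 stab] := mild_stability.
set k := Num.floor t.
have ktk : k%:~R <= t <= (k + 1)%:~R by rewrite floor_le ltW// floorD1_gt.
pose v j (s : R) := limn (fun n => w_ n j s).
have mphi n j : measurable_fun setT (phi_ n j) by have [] := mw_ n.
have phiM n j s : `|phi_ n j s| <= M by have [] := mw_ n.
have bphi n j : bmeas (phi_ n j) by split=> //; exists M.
have bphi' j : bmeas (phi j).
  split.
    by apply: (measurable_fun_cvg (h := fun n => phi_ n j)) => // s _; exact: phicvg.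
  by exists M => s; apply: cvgn_norm_le (phicvg j s) => n.
apply: (@cvgn_dist_le _ _ (fun n => C * stability_gap (phi_ n) phi (w_ n) v k)).
  move=> n m; rewrite (le_trans (stab M _ _ _ _ k i t (mw_ n) (mw_ m) ktk))//.
  rewrite -mulrDr ler_wpM2l// -big_split/= ler_sum// => j _.
  rewrite addrACA lerD//.
    by rewrite [X in _ <= _ + X]distrC (le_trans _ (ler_normD _ _))// addrA subrK.
  have b1 l : bmeas (fun s => `|phi_ l j s - phi j s|) by exact/bmeas_norm/bmeasB.
  rewrite -RintegralD//; [|exact: bmeas_integrable..].
  apply: bmeas_le_Rintegral; [exact/bmeas_norm/bmeasB|exact: bmeasD|].
  move=> s _.
  by rewrite [X in _ <= _ + X]distrC (le_trans _ (ler_normD _ _))// addrA subrK.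
rewrite -[X in _ --> X](mulr0 C); apply: cvgMr.
exact: (@stability_gap_cvg0 M).
Qed.

(** [phi], a mere pointwise limit, need not be continuous inside the cells, and
    [w] need not be differentiable there: this is why the equation is taken in
    integral form. *)
Lemma mild_lim M (phi_ w_ : nat -> 'I_p -> R -> R) phi w :
  (forall n, mild M (phi_ n) (w_ n)) ->
  (forall i t, phi_ n i t @[n --> \oo] --> phi i t) ->
  (forall i t, w_ n i t @[n --> \oo] --> w i t) ->
  mild M phi w.
Proof.
move=> mw_ phicvg wcvg; split.
- move=> i; apply: (measurable_fun_cvg (h := fun n => w_ n i)) => [n|t _].
    by have [] := mw_ n.
  exact: wcvg.
- move=> i; apply: (measurable_fun_cvg (h := fun n => phi_ n i)) => [n|t _].
    by have [] := mw_ n.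
  exact: phicvg.
- by move=> i t; apply: cvgn_norm_le (wcvg i t) => n; have [] := mw_ n.
- by move=> i t; apply: cvgn_norm_le (phicvg i t) => n; have [] := mw_ n.
move=> k i t ktk.
have eq_n n : w_ n i t = w_ n i k%:~R +
    \int[mu]_(s in `[k%:~R, t]) depca_field (phi_ n) (w_ n) k i s.
  by have [_ _ _ _] := mw_ n; exact.
suff : w_ n i t @[n --> \oo] -->
    w i k%:~R + \int[mu]_(s in `[k%:~R, t]) depca_field phi w k i s.
  by move=> wcvg'; apply: (cvg_unique _ (wcvg i t) wcvg').
under eq_cvg do rewrite eq_n.
apply: cvgD; first exact: wcvg.
apply: bounded_convergence_Rintegral => [n|n s|s].
- by have [] := bmeas_depca_field _ _ _ k i (mw_ n).
- exact: depca_field_bound.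
- apply: cvgD; last exact: phicvg.
  apply: cvgD; first by apply: cvg_sum => j; apply: cvgMr; exact: wcvg.
  by apply: cvg_sum => j; apply: cvgMr; exact: wcvg.
Qed.

(** Within one cell this bounds an integral of a bounded field. Two points at
    distance at most 1 lie in the same cell or in adjacent ones, and then the
    common endpoint of the cells is inserted between them. *)
Lemma mild_lipschitz M phi w i s t : mild M phi w -> `|t - s| <= 1 ->
  `|w i t - w i s| <= (mx_l1 A + mx_l1 B + 1) * M * `|t - s|.
Proof.
move=> mw; set K := _ * M.
have cell k u v : k%:~R <= u -> u <= v -> v <= (k + 1)%:~R ->
    `|w i v - w i u| <= K * (v - u).
  move=> ku uv vk; have [_ _ _ _ weq] := mw.
  rewrite (weq k i v) ?(le_trans ku uv)// (weq k i u) ?ku ?(le_trans uv vk)//.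
  rewrite opprD addrACA subrr add0r.
  apply: bmeas_dist_Rintegral => //; first exact: (bmeas_depca_field M).
  by move=> x; exact: depca_field_bound.
wlog st : s t / s <= t.
  move=> H; have [/H//|/ltW/H ts] := leP s t.
  by rewrite distrC [`|w i t - _|]distrC.
rewrite ger0_norm ?subr_ge0// => ts1; set k := Num.floor s.
have ks : k%:~R <= s := floor_le s.
have [tk|kt] := leP t (k + 1)%:~R; first exact: (cell k).
have sk : s <= (k + 1)%:~R by exact/ltW/floorD1_gt.
have -> : w i t - w i s =
  (w i t - w i (k + 1)%:~R) + (w i (k + 1)%:~R - w i s) by ring.
have -> : K * (t - s) = K * (t - (k + 1)%:~R) + K * ((k + 1)%:~R - s) by ring.
rewrite (le_trans (ler_normD _ _))// lerD//; last exact: (cell k).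
apply: (cell (k + 1)) => //; first exact: ltW.
rewrite intrD (le_trans (y := s + 1))//; first by rewrite -lerBlDl.
by rewrite lerD2r.
Qed.

End MildSolutions.

(** * Piecewise continuous functions *)

Section PiecewiseContinuous.
Context {R : realType}.
Implicit Types (F w : R -> R) (a b t : R).
Notation mu := (@lebesgue_measure R).

(** The preimage of an open set is the union of its interior and of a set of
    integers: a preimage point outside the interior is a discontinuity. *)
Lemma measurable_fun_continuous_Nint F :
  (forall t, t \isn't a Num.int -> {for t, continuous F}) ->
  measurable_fun setT F.
Proof.
move=> cF mT; apply: (measurability _ (RGenOInfty.measurableE R)) => //.
move=> _ [_ [x ->] <-]; rewrite setTI.
set P := F @^-1` _.
have -> : P = P^° `|` (P `&` range (fun n : int => n%:~R)).
  apply/seteqP; split => [t Pt|t [/interior_subset//|[]//]].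
  have [/intrP[n tn]|tNint] := boolP (t \is a Num.int).
    by right; split=> //; exists n.
  left; apply: (cF t tNint); apply: open_nbhs_nbhs; split; last exact: Pt.
  exact: rray_open.
apply: measurableU; first by apply: open_measurable; exact: open_interior.
apply: countable_measurable => [t|]; first exact: measurable_set1.
apply: (sub_countable (subset_card_le (@subIsetr _ _ _))).
exact: (sub_countable (card_image_le _ _) (countableP _)).
Qed.

(** The values of [F] at [a] and [b] are arbitrary. Replacing them by the lateral
    limits gives a function [G] continuous on the closed segment, with the same
    integral. *)
Lemma FTC_open_interval F w a b : a < b -> measurable_fun setT F ->
  continuous w ->
  (forall t, a < t < b -> is_derive t 1 w (F t)) ->
  (forall t, a < t < b -> {for t, continuous F}) ->
  cvg (F @ a^'+) -> cvg (F @ b^'-) ->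
  w b = w a + \int[mu]_(s in `[a, b]) F s.
Proof.
move=> ab mF cw dw cF Fa Fb.
pose G s := if s == a then lim (F @ a^'+) else if s == b then lim (F @ b^'-) else F s.
have GF t : a < t < b -> G t = F t.
  by move=> /andP[at_ tb]; rewrite /G gt_eqF// lt_eqF.
have ba : b != a by rewrite gt_eqF.
have Ga : F @ a^'+ --> G a by rewrite /G eqxx.
have Gb : F @ b^'- --> G b by rewrite /G (negPf ba) eqxx.
have cG : {within `[a, b], continuous G}.
  apply/continuous_within_itvP => //; split.
  - move=> t; rewrite in_itv/= => atb.
    rewrite /continuous_at (GF t atb).
    apply: cvg_trans (cF t atb); apply: near_eq_cvg.
    near=> s; rewrite GF//; near: s.
    have : t \in `]a, b[%R by rewrite in_itv.
    exact: near_in_itvoo.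
  - apply: cvg_trans Ga; apply: near_eq_cvg; near=> s; rewrite GF//.
    by apply/andP; split; near: s; [exact: nbhs_right_gt|exact: nbhs_right_lt].
  - apply: cvg_trans Gb; apply: near_eq_cvg; near=> s; rewrite GF//.
    by apply/andP; split; near: s; [exact: nbhs_left_gt|exact: nbhs_left_lt].
have mG : measurable_fun `]a, b[ (EFin \o G).
  apply: (eq_measurable_fun (EFin \o F)).
    by move=> t; rewrite inE/= in_itv/= => /GF ->.
  by apply/measurable_EFinP; exact: measurable_funTS.
have mF' : measurable_fun `]a, b[ (EFin \o F).
  by apply/measurable_EFinP; exact: measurable_funTS.
have -> : \int[mu]_(s in `[a, b]) F s = \int[mu]_(s in `[a, b]) G s.
  rewrite /Rintegral; congr fine.
  rewrite (integral_itv_bndoo _ _ mF') (integral_itv_bndoo _ _ mG).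
  by apply: eq_integral => t; rewrite inE/= in_itv/= => /GF ->.
rewrite /Rintegral (@continuous_FTC2 _ G w)//=; last 2 first.
- split; first by move=> t; rewrite in_itv/= => /dw[].
  + exact/cvg_at_right_filter/cw.
  + exact/cvg_at_left_filter/cw.
- by move=> t; rewrite in_itv/= => atb; rewrite GF// derive1E; have [_ ->] := dw t atb.
by rewrite addrCA subrr addr0.
Unshelve. all: end_near. Qed.

End PiecewiseContinuous.

(** * Real and imaginary parts of complex vectors *)

Section ComplexParts.
Context {R : realType} {p : nat}.
Implicit Types (x : R -> 'cV[Cplx R]_p) (z : Cplx R).

(** Both parts are handled at once, by quantifying over the boolean [re]. *)
Definition cpart (re : bool) z : R := if re then complex.Re z else complex.Im z.

Lemma cpartB re z1 z2 : cpart re (z1 - z2) = cpart re z1 - cpart re z2.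
Proof. by case: re z1 z2 => -[a b] [c d]. Qed.

Lemma cpartD re z1 z2 : cpart re (z1 + z2) = cpart re z1 + cpart re z2.
Proof. by case: re z1 z2 => -[a b] [c d]. Qed.

Lemma cpartZ re (a : R) z : cpart re (a%:C * z) = a * cpart re z.
Proof. by case: re z => -[c d] /=; rewrite mul0r ?subr0 ?addr0. Qed.

Lemma cpart_sum re I (s : seq I) (F : I -> Cplx R) :
  cpart re (\sum_(i <- s) F i) = \sum_(i <- s) cpart re (F i).
Proof.
elim: s => [|i s IHs]; first by rewrite !big_nil; case: re.
by rewrite !big_cons cpartD IHs.
Qed.

Lemma cpart_norm_le re z : (`|cpart re z|)%:C <= `|z| :> Cplx R.
Proof.
case: re => /=; first exact: normc_ge_Re.
case: z => a b; rewrite /= normc_def lecR -sqrtr_sqr ler_wsqrtr//=.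
by rewrite lerDr sqr_ge0.
Qed.

Lemma norm_le_cpart z (e : R) : (forall re, `|cpart re z| < e) ->
  `|z| < (2 * e)%:C.
Proof.
move=> ze; have e0 : 0 < e := le_lt_trans (normr_ge0 _) (ze true).
rewrite normc_def ltcR -(@ger0_norm _ (2 * e)) ?mulr_ge0 1?ltW//.
rewrite -sqrtr_sqr ltr_sqrt ?exprn_gt0 ?mulr_gt0//.
have sq re : cpart re z ^+ 2 < e ^+ 2.
  by rewrite -[X in X < _]real_normK ?num_real// ltrXn2r ?nnegrE// ltW.
have := sq true; have := sq false; rewrite /= exprMn; nra.
Qed.

(** The topology of the modulus is that of the real coordinates; everything below
    takes place in real analysis through this equivalence. *)
Lemma cvg_cpartP {T} (F : set_system T) {FF : Filter F}
    (v : T -> 'cV[Cplx R]_p) (l : 'cV[Cplx R]_p) :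
  v n @[n --> F] --> l <->
  forall re i, cpart re (v n i 0) @[n --> F] --> cpart re (l i 0).
Proof.
split=> [vl re i|vl].
  have vli : v n i 0 @[n --> F] --> l i 0.
    exact: (cvg_comp _ _ vl (@coord_continuous _ _ _ i 0 l)).
  apply/cvgrPdist_lt => e e0.
  have eC0 : 0 < e%:C :> Cplx R by rewrite ltcR.
  move/cvgrPdist_lt : vli => /(_ _ eC0); apply: filterS => n ne.
  by rewrite -cpartB -ltcR; apply: le_lt_trans ne; exact: cpart_norm_le.
apply/cvg_ballP => e e0.
(* A positive complex number is real. *)
have eE : e = (complex.Re e)%:C by rewrite RRe_real// gtr0_real.
have e2 : 0 < complex.Re e / 2 by move: e0; rewrite eE ltcR => e0; rewrite divr_gt0.
have : \forall n \near F, forall (q : bool * 'I_p),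
    `|cpart q.1 (l q.2 0) - cpart q.1 (v n q.2 0)| < complex.Re e / 2.
  apply: filter_forall => -[re i] /=.
  by move/cvgrPdist_lt : (vl re i); exact.
apply: filterS => n ne; split=> // i j; rewrite ord1 /ball/=.
have -> : e = (2 * (complex.Re e / 2))%:C by rewrite mulrC divfK// -eE.
by apply: norm_le_cpart => re; rewrite cpartB; exact: (ne (re, i)).
Qed.

Lemma bounded_cpart x : bounded_fun x ->
  exists M : R, forall re i t, `|cpart re (x t i 0)| <= M.
Proof.
move=> [M [Mreal xM]]; pose N : Cplx R := `|M| + 1.
have MN : M < N by rewrite (le_lt_trans (real_ler_norm Mreal))// ltrDl.
exists (complex.Re N) => re i t.
have xN : `|x t i 0| <= N.
  apply: le_trans (xM N MN t I); rewrite -[leRHS]/(mx_norm (x t)) mx_normE.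
  rewrite -[leLHS]nngE num_le.
  exact: (le_bigmax _ (fun ij : 'I_p * 'I_1 => `|x t ij.1 ij.2|%:nng) (i, 0)).
have := le_trans (cpart_norm_le re (x t i 0)) xN.
by rewrite lecE /= => /andP[].
Qed.

End ComplexParts.

(** * Solutions satisfy the integral equation *)

Section SolutionsAreMild.
Context {R : realType} {p : nat}.
Implicit Types (A B : 'M[R]_p) (f x : R -> 'cV[Cplx R]_p).

Definition cparts (re : bool) x (i : 'I_p) (t : R) : R := cpart re (x t i 0).

Lemma cvg_shift_at_right (a m : R) : (s + m) @[s --> a^'+] --> (a + m)^'+.
Proof.
move=> P [e e0 eP]; exists e => // s ase as_; apply: eP; last by rewrite ltrD2r.
by move: ase; rewrite /ball/= opprD addrACA subrr addr0.
Qed.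

Lemma cvg_shift_at_left (a m : R) : (s + m) @[s --> a^'-] --> (a + m)^'-.
Proof.
move=> P [e e0 eP]; exists e => // s ase as_; apply: eP; last by rewrite ltrD2r.
by move: ase; rewrite /ball/= opprD addrACA subrr addr0.
Qed.

Lemma has_deriv_cparts x (t m : R) d re i : has_deriv x (t + m) d ->
  is_derive t 1 (fun s : R => cparts re x i (s + m)) (cpart re (d i 0)).
Proof.
move=> /cvg_cpartP /(_ re i) xd.
have xd' : h^-1 *: (((fun s : R => cparts re x i (s + m)) \o shift t) (h *: 1)
    - cparts re x i (t + m)) @[h --> (0 : R)^'] --> cpart re (d i 0).
  apply: cvg_trans xd; apply: near_eq_cvg; apply: nearW => h /=.
  rewrite /diff_quot !mxE cpartZ cpartB /cparts [h *: 1]mulr1.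
  by congr (_ * (cpart re (x _ _ _) - _)); ring.
split; first exact: (cvgP _ xd').
exact: cvg_lim xd'.
Qed.

Lemma cpart_mulmx re (C : 'M[R]_p) (v : 'cV[Cplx R]_p) i :
  cpart re ((map_mx (real_complex R) C *m v) i 0)
  = \sum_j C i j * cpart re (v j 0).
Proof.
rewrite mxE cpart_sum; apply: eq_bigr => j _.
by rewrite mxE cpartZ.
Qed.

Lemma int_not_between (k : int) (t : R) :
  k%:~R < t < (k + 1)%:~R -> t \isn't a Num.int.
Proof.
move=> /andP[kt tk]; apply/negP => /intrP[n tn].
by move: kt tk; rewrite tn !ltr_int ltzD1 => /lt_le_trans h /h; rewrite ltxx.
Qed.

(** All integer translates are treated together: translating by [m] maps cells to
    cells, so the equation for [x] on [[k + m, k + m + 1]] is the translated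
    equation on [[k, k + 1]], and no change of variables in integrals is needed. *)
Lemma solution_mild A B f x : BPC f -> is_solution A B f x -> bounded_fun x ->
  exists M, forall re (m : int),
    mild A B M (fun i (t : R) => cparts re f i (t + m%:~R))
               (fun i (t : R) => cparts re x i (t + m%:~R)).
Proof.
move=> [fb fc flim] [xc _ _ xd _] xb.
have [Mf fM] := bounded_cpart _ fb; have [Mx xM] := bounded_cpart _ xb.
exists (Num.max Mx Mf) => re m.
have xc' i : continuous (cparts re x i).
  by move=> t; have /cvg_cpartP/(_ re i) := xc t.
have shiftc : continuous (fun t : R => t + m%:~R).
  by move=> t; apply: cvgD; [exact: cvg_id|exact: cvg_cst].
have xsc i : continuous (fun t : R => cparts re x i (t + m%:~R)).
  move=> t.
  exact: (@continuous_comp R R R (+%R^~ m%:~R) (cparts re x i) t (shiftc t) (xc' i _)).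
have fc' i t : t \isn't a Num.int -> {for t, continuous (cparts re f i)}.
  by move=> /fc ft; have /cvg_cpartP/(_ re i) := ft.
have mx i : measurable_fun setT (fun t : R => cparts re x i (t + m%:~R)).
  exact: continuous_measurable_fun.
have mf i : measurable_fun setT (fun t : R => cparts re f i (t + m%:~R)).
  apply: (measurableT_comp (f := cparts re f i)).
    exact: measurable_fun_continuous_Nint (fc' i).
  exact: continuous_measurable_fun.
split=> //.
- by move=> i t; rewrite le_max xM.
- by move=> i t; rewrite le_max fM orbT.
move=> k i t /andP[]; rewrite le_eqVlt => /predU1P[<- _|kt tk].
  by rewrite set_itv1 Rintegral_set1 addr0.
have inside (u : R) : k%:~R < u < (k + 1)%:~R ->
    (k + m)%:~R < u + m%:~R < (k + m + 1)%:~R.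
  move=> /andP[ku uk]; rewrite intrD ltrD2r ku/=.
  by rewrite -addrA [m + 1]addrC addrA intrD ltrD2r.
have below (u : R) : k%:~R < u < t -> k%:~R < u < (k + 1)%:~R.
  by move=> /andP[-> ut]; exact: lt_le_trans tk.
have fsc j (u : R) : k%:~R < u < (k + 1)%:~R ->
    {for u, continuous (fun s : R => cparts re f j (s + m%:~R))}.
  move=> kuk; exact: (@continuous_comp R R R (+%R^~ m%:~R) (cparts re f j) u
    (shiftc u) (fc' j _ (int_not_between _ _ (inside _ kuk)))).
pose field := depca_field A B (fun i (t : R) => cparts re f i (t + m%:~R))
  (fun i (t : R) => cparts re x i (t + m%:~R)) k i.
have field_cvg (F : set_system R) (FF : Filter F) (u l : R) : F --> u ->
    cparts re f i (s + m%:~R) @[s --> F] --> l ->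
    field s @[s --> F] --> \sum_j A i j * cparts re x j (u + m%:~R)
      + \sum_j B i j * cparts re x j (k%:~R + m%:~R) + l.
  move=> Fu fl; apply: cvgD; last exact: fl.
  apply: cvgD; last exact: cvg_cst.
  apply: cvg_sum => j; apply: cvgMr; exact: (cvg_comp _ _ Fu (xsc j u)).
have at_right_u (u : R) : u^'+ --> u by exact: cvg_within.
have at_left_u (u : R) : u^'- --> u by exact: cvg_within.
apply: (@FTC_open_interval _ field (fun t : R => cparts re x i (t + m%:~R))) => //.
- apply: measurable_funD => //; apply: measurable_funD => //.
  by apply: measurable_sum => j; apply: measurable_funM.
- move=> u kut.
  have := has_deriv_cparts _ _ _ _ re i (xd _ _ (inside _ (below _ kut))).
  rewrite /depca_rhs mxE mxE !cpartD !cpart_mulmx.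
  have -> : Num.floor (u + m%:~R) = k + m.
    apply: floor_def; have /andP[/ltW -> ->] := inside _ (below _ kut).
    by [].
  by rewrite intrD.
- move=> u kut; apply: field_cvg => //.
  exact: fsc (below _ kut).
- have [_ /cvg_ex[l /cvg_cpartP/(_ re i) fl]] := flim (k + m).
  apply/cvg_ex; eexists; apply: (field_cvg _ _ k%:~R) => //.
  apply: (cvg_comp _ _ (cvg_shift_at_right k%:~R m%:~R)).
  by rewrite -intrD; exact: fl.
(* At the right end of the cell only the lateral limit of [f] is usable. *)
- move: tk; rewrite le_eqVlt => /predU1P[tk|tk].
    have [/cvg_ex[l /cvg_cpartP/(_ re i) fl] _] := flim (k + 1 + m).
    apply/cvg_ex; eexists; apply: (field_cvg _ _ t) => //.
    apply: (cvg_comp _ _ (cvg_shift_at_left t m%:~R)).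
    by rewrite tk -intrD; exact: fl.
  have ktk : k%:~R < t < (k + 1)%:~R by rewrite kt.
  apply/cvg_ex; eexists; apply: (field_cvg _ _ t) => //.
  exact: (cvg_comp _ _ (at_left_u t) (fsc i t ktk)).
Qed.

End SolutionsAreMild.

(** * Almost automorphy *)

Section AlmostAutomorphic.
Context {R : realType} {p : nat}.
Implicit Types (A B : 'M[R]_p) (f x : R -> 'cV[Cplx R]_p).

Lemma increasing_seq_cvg_infty (phi : nat -> nat) : increasing_seq phi ->
  phi n @[n --> \oo] --> \oo.
Proof.
move=> /increasing_seqP phiS P [N _ NP].
have le_phi n : (n <= phi n)%N.
  by elim: n => // n IHn; apply: leq_ltn_trans IHn (phiS n).
by exists N => // n /= Nn; apply: NP; exact: leq_trans (le_phi n).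
Qed.

Lemma cvg_subseq (T : topologicalType) (u : nat -> T) (l : T) (phi : nat -> nat) :
  increasing_seq phi -> u n @[n --> \oo] --> l -> u (phi n) @[n --> \oo] --> l.
Proof. by move=> /increasing_seq_cvg_infty phioo; exact: cvg_comp. Qed.

Lemma cvg_lipschitz_perturb (K : R) (w : R -> R) (a b : nat -> R) (l : R) :
  (forall s t, `|t - s| <= 1 -> `|w t - w s| <= K * `|t - s|) ->
  b n - a n @[n --> \oo] --> (0 : R) ->
  w (a n) @[n --> \oo] --> l -> w (b n) @[n --> \oo] --> l.
Proof.
move=> wK ab wl.
have -> : (fun n => w (b n)) = (fun n => (w (b n) - w (a n)) + w (a n)).
  by apply/funext => n; rewrite subrK.
rewrite -[l]add0r; apply: cvgD => //; apply/norm_cvg0P.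
apply: (squeeze_cvgr (f := fun=> 0) (h := fun n => K * `|b n - a n|)).
- near=> n; rewrite normr_ge0/=; apply: wK; near: n.
  have : \forall n \near \oo, `|0 - (b n - a n)| <= 1.
    by move/cvgrPdist_le : ab; exact.
  by apply: filterS => n; rewrite sub0r normrN.
- exact: cvg_cst.
- rewrite -[X in _ --> X](mulr0 K); apply: cvgMr.
  exact/norm_cvg0P.
Unshelve. all: end_near. Qed.

Lemma frac_subseq (s : nat -> R) : exists2 phi : nat -> nat,
  increasing_seq phi & cvgn (fun n => s (phi n) - (Num.floor (s (phi n)))%:~R).
Proof.
apply: (@bolzano_weierstrass _ (fun n => s n - (Num.floor (s n))%:~R)).
exists 1; split => // c c1 n _ /=; apply: le_trans (ltW c1).
have /andP[fl fu] := floor_itv (s n).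
by rewrite ger0_norm ?subr_ge0// lerBlDl -[1]/(1%:~R) -intrD ltW.
Qed.

(** [y] is the limit given by [mild_cauchy]. Its translate by [- N n] is itself a
    pointwise limit, of the translates of [x] by [N j - N n], so [mild_lim] gives
    its equation and [mild_cvg] compares it with [x]. *)
Lemma integer_translates_cvg A B f x (ft : R -> 'cV[Cplx R]_p)
    (v : int -> 'cV[Cplx R]_p) (N : nat -> int) :
  BPC f -> is_solution A B f x -> bounded_fun x ->
  (forall t, f (t + (N n)%:~R) @[n --> \oo] --> ft t /\
             ft (t - (N n)%:~R) @[n --> \oo] --> f t) ->
  (forall k : int, x (k + N n)%:~R @[n --> \oo] --> v k /\
             v (k - N n) @[n --> \oo] --> x k%:~R) ->
  exists K, exists y : R -> 'cV[Cplx R]_p,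
    [/\ forall t, x (t + (N n)%:~R) @[n --> \oo] --> y t,
        forall t, y (t - (N n)%:~R) @[n --> \oo] --> x t &
        forall z, z = x \/ z = y -> forall re i s t, `|t - s| <= 1 ->
          `|cpart re (z t i 0) - cpart re (z s i 0)| <= K * `|t - s|].
Proof.
move=> fbpc xsol xb ftN vN; have [M xM] := solution_mild _ _ _ _ fbpc xsol xb.
have fN re i t : cparts re f i (t + (N n)%:~R) @[n --> \oo] --> cparts re ft i t.
  by have [/cvg_cpartP/(_ re i)] := ftN t.
have xk re k i :
    cparts re x i (k%:~R + (N n)%:~R) @[n --> \oo] --> cpart re (v k i 0).
  have [/cvg_cpartP/(_ re i) + _] := vN k; rewrite /cparts.
  by under eq_cvg do rewrite intrD.
have xcvg re i t : cvgn (fun n => cparts re x i (t + (N n)%:~R)).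
  apply: (mild_cauchy _ _ M (fun n i (t : R) => cparts re f i (t + (N n)%:~R))
    (fun n i (t : R) => cparts re x i (t + (N n)%:~R)) _ (fun n => xM re (N n)) (fN re)).
  by move=> k j; apply/cvg_ex; eexists; exact: xk.
pose Y re i t : R := limn (fun n => cparts re x i (t + (N n)%:~R)).
pose y t : 'cV[Cplx R]_p := \matrix_(i, j) ((Y true i t) +i* (Y false i t))%C.
have yY re i t : cpart re (y t i 0) = Y re i t by rewrite mxE; case: re.
have xy re i t : cparts re x i (t + (N n)%:~R) @[n --> \oo] --> cparts re y i t.
  by rewrite /cparts yY; exact: xcvg.
have yk k : y k%:~R = v k.
  apply/matrixP => i j; rewrite ord1.
  have yv re : cpart re (y k%:~R i 0) = cpart re (v k i 0).
    by rewrite yY; apply/cvg_lim => //; exact: xk.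
  by move: (yv true) (yv false); case: (y _ i 0) (v k i 0) => a b [c d] /= -> ->.
have ymild re (m : int) : mild A B M (fun i (t : R) => cparts re ft i (t + m%:~R))
    (fun i (t : R) => cparts re y i (t + m%:~R)).
  apply: (mild_lim _ _ M (fun n i (t : R) => cparts re f i (t + m%:~R + (N n)%:~R))
    (fun n i (t : R) => cparts re x i (t + m%:~R + (N n)%:~R))) => //.
  move=> n; have shift2 (z : R -> 'cV[Cplx R]_p) :
      (fun i (t : R) => cparts re z i (t + m%:~R + (N n)%:~R)) =
      (fun i (t : R) => cparts re z i (t + (m + N n)%:~R)).
    by apply/funext => i; apply/funext => t; rewrite intrD addrA.
  by rewrite !shift2; exact: xM.
exists ((mx_l1 A + mx_l1 B + 1) * M), y; split.
- by move=> t; apply/cvg_cpartP => re i; exact: xy.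
- move=> t; apply/cvg_cpartP => re i.
  have -> : cpart re (x t i 0) = cparts re x i (t + 0%:~R) by rewrite addr0.
  have ftf j s : cparts re ft j (s + (- N n)%:~R) @[n --> \oo] -->
      cparts re f j (s + 0%:~R).
    rewrite addr0; under eq_cvg do rewrite intrN.
    by have [_ /cvg_cpartP/(_ re j)] := ftN s.
  have yx k j : cparts re y j (k%:~R + (- N n)%:~R) @[n --> \oo] -->
      cparts re x j (k%:~R + 0%:~R).
    rewrite addr0; under eq_cvg do rewrite -intrD /cparts yk.
    by have [_ /cvg_cpartP/(_ re j)] := vN k.
  have := mild_cvg A B M _ _ _ _ (fun n => ymild re (- N n)) (xM re 0) ftf yx i t.
  by under eq_cvg do rewrite /cparts intrN.
- move=> z zxy re i s t.
  have noshift (u : R -> 'cV[Cplx R]_p) :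
      cparts re u = (fun i (t : R) => cparts re u i (t + 0%:~R)).
    by apply/funext => j; apply/funext => u'; rewrite addr0.
  have [psi zm] : exists psi, mild A B M psi (cparts re z).
    case: zxy => ->; rewrite (noshift _).
      by exists (fun i (t : R) => cparts re f i (t + 0%:~R)); exact: xM.
    by exists (fun i (t : R) => cparts re ft i (t + 0%:~R)); exact: ymild.
  exact: mild_lipschitz zm.
Qed.

(** With [r] the limit of the fractional parts, [x (t + s)] is close to
    [x (t + r + N)] and [y (t - s + r)] is close to [y (t - N)], by the common
    Lipschitz bound. *)
Lemma almost_automorphic_of_integers A B f x :
  Z_almost_automorphic f -> is_solution A B f x -> bounded_fun x ->
  discrete_almost_automorphic (fun n : int => x n%:~R) -> almost_automorphic x.
Proof.
move=> [fbpc fZ] xsol xb xZ.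
split=> //; first by have [] := xsol.
move=> s; have [phi1 phi1S s1r] := frac_subseq s.
pose m1 n := Num.floor (s (phi1 n)).
have [phi2 [phi2S [ft ftE]]] := fZ m1.
have [phi3 [phi3S [v vE]]] := xZ (m1 \o phi2).
pose N n := m1 (phi2 (phi3 n)).
pose psi n := phi1 (phi2 (phi3 n)).
pose r := lim (s (phi1 n) - (m1 n)%:~R @[n --> \oo]).
have rE : s (psi n) - (N n)%:~R @[n --> \oo] --> r.
  exact: (cvg_subseq _ _ _ _ phi3S (cvg_subseq _ _ _ _ phi2S s1r)).
have ftN t : f (t + (N n)%:~R) @[n --> \oo] --> ft t /\
             ft (t - (N n)%:~R) @[n --> \oo] --> f t.
  by have [h1 h2] := ftE t; split; [exact: cvg_subseq h1|exact: cvg_subseq h2].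
have [K [y [xy yx lip]]] := integer_translates_cvg A B f x ft v N fbpc xsol xb ftN vE.
exists psi; split.
  by move=> n m; exact: etrans (phi1S _ _) (etrans (phi2S _ _) (phi3S _ _)).
exists (fun t => y (t + r)) => t; split; apply/cvg_cpartP => re i.
- apply: (cvg_lipschitz_perturb K (fun t => cpart re (x t i 0))
    (fun n => t + r + (N n)%:~R) (fun n => t + s (psi n))).
  + exact: (lip x (or_introl erefl) re i).
  + rewrite -[X in _ --> X](subrr r).
    have -> : (fun n => t + s (psi n) - (t + r + (N n)%:~R)) =
      (fun n => s (psi n) - (N n)%:~R - r) by apply/funext => n; ring.
    by apply: cvgB => //; exact: cvg_cst.
  + by have /cvg_cpartP/(_ re i) := xy (t + r).
- apply: (cvg_lipschitz_perturb K (fun t => cpart re (y t i 0))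
    (fun n => t - (N n)%:~R) (fun n => t - s (psi n) + r)).
  + exact: (lip y (or_intror erefl) re i).
  + rewrite -[X in _ --> X](subrr r).
    have -> : (fun n => t - s (psi n) + r - (t - (N n)%:~R)) =
      (fun n => r - (s (psi n) - (N n)%:~R)) by apply/funext => n; ring.
    by apply: cvgB => //; exact: cvg_cst.
  + by have /cvg_cpartP/(_ re i) := yx t.
Qed.

Lemma discrete_of_almost_automorphic x : almost_automorphic x ->
  discrete_almost_automorphic (fun n : int => x n%:~R).
Proof.
move=> [_ _ xaa] s; have [phi [phiS [g xg]]] := xaa (fun n => (s n)%:~R).
exists phi; split=> //; exists (fun k => g k%:~R) => k.
have [h1 h2] := xg k%:~R; split.
  by under eq_cvg do rewrite intrD; exact: h1.
by under eq_cvg do rewrite intrD intrN; exact: h2.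
Qed.

End AlmostAutomorphic.

Theorem theorem4p5 (R : realType) (p : nat) (A B : 'M[R]_p)
    (f x : R -> 'cV[Cplx R]_p) :
  B != 0 ->
  (forall (n : int) (t tau : R),
     n%:~R <= t <= (n + 1)%:~R -> n%:~R <= tau <= (n + 1)%:~R ->
     Zmx A B t tau \in unitmx) ->
  Z_almost_automorphic f ->
  is_solution A B f x ->
  bounded_fun x ->
  almost_automorphic x <->
  discrete_almost_automorphic (fun n : int => x n%:~R).
Proof.
move=> _ _ fZ xsol xb; split; first exact: discrete_of_almost_automorphic.
exact: (almost_automorphic_of_integers A B f).
Qed.
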